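(* There exists a universal constant $C_0>0$ such that, for every $0<a\leq b$, every $T>0$ and every integer $n\geq 2$, $$R(a,b,T,n)\le \frac{C_0\, a}{(1+b^2)\,T}.$$ Moreover, the same result holds true when the infimum defining $R(a,b,T,n)$ is restricted to those matrix functions $S\in \mathrm{Sym}_n^{(PE)}(a,b,T)$ that have rank at most $1$, i.e. $S=cc^\top$ with $c$ taking values in $\mathbb{R}^n$.
   Context: For $0<a\le b$, $T>0$ and an integer $n\ge 1$, $\mathrm{Sym}_n^{(PE)}(a,b,T)$ denotes the set of locally integrable functions $S$ on $[0,+\infty)$ with values in the positive semi-definite symmetric real $n\times n$ matrices such that $$a\,\mathrm{Id}_n \le \int_t^{t+T} S(\tau)\,d\tau\le b\,\mathrm{Id}_n\qquad\text{for all } t\ge 0,$$ inequalities being understood in the sense of quadratic forms. For such $S$, $\Phi_S(t,0)$ is the fundamental matrix of $\dot x(t)=-S(t)x(t)$, i.e. the value at time $t$ of the solution of $\dot M=-SM$, $M(0)=\mathrm{Id}_n$. The exponential decay rate is $$R(S):=-\limsup_{t\to+\infty}\frac{\log\|\Phi_S(t,0)\|}{t},$$ and the worst exponential decay rate is $R(a,b,T,n):=\inf\{R(S)\mid S\in \mathrm{Sym}_n^{(PE)}(a,b,T)\}$. *)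

(* Defs.v *)
From HB Require Import structures.
From mathcomp Require Import all_boot all_order all_algebra.
From mathcomp Require Import all_classical all_reals all_analysis.
Set Implicit Arguments.
Unset Strict Implicit.
Unset Printing Implicit Defensive.
Import Order.TTheory GRing.Theory Num.Theory.
Import numFieldNormedType.Exports.
Local Open Scope classical_set_scope.
Local Open Scope ring_scope.

Section defs.
Context {R : realType}.
Local Notation mu := (@lebesgue_measure R).

Definition qform n (A : 'M[R]_n) (x : 'cV[R]_n) : R := (x^T *m A *m x) 0 0.

Definition le_qform n (A B : 'M[R]_n) := forall x, qform A x <= qform B x.

Definition psd n (A : 'M[R]_n) := A^T = A /\ le_qform 0 A.

Definition loc_integrable n (S : R -> 'M[R]_n) :=
  forall t i j, mu.-integrable `[0, t] (fun u => (S u i j)%:E).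

Definition mx_integral n (s t : R) (S : R -> 'M[R]_n) : 'M[R]_n :=
  \matrix_(i, j) \int[mu]_(u in `[s, t]) S u i j.

(* Functions on [0, +oo[ are total functions on R whose values at negative
   times are irrelevant. *)
Definition Sym_PE n (a b T : R) : set (R -> 'M[R]_n) :=
  [set S | [/\ loc_integrable S,
     forall t, 0 <= t -> psd (S t) &
     forall t, 0 <= t -> le_qform a%:M (mx_integral t (t + T) S) /\
                         le_qform (mx_integral t (t + T) S) b%:M]].

Definition rank_le1 n : set (R -> 'M[R]_n) :=
  [set S | exists c : R -> 'cV[R]_n,
     forall t, 0 <= t -> S t = c t *m (c t)^T].

(* Since S is only locally integrable, M' = - S M, M(0) = Id is understood in
   the sense of Caratheodory: M is the (absolutely continuous) solution of
   the associated integral equation. *)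
Definition fundamental_solution n (S M : R -> 'M[R]_n) :=
  loc_integrable (fun t => S t *m M t) /\
  forall t, 0 <= t -> M t = 1%:M - mx_integral 0 t (fun u => S u *m M u).

(* A locally integrable S has a fundamental solution, whose values at t >= 0
   are unique, so that neither the choice nor the default value matters. *)
Definition Phi n (S : R -> 'M[R]_n) : R -> 'M[R]_n :=
  xget (fun=> 1%:M) [set M | fundamental_solution S M].

Definition enorm n (x : 'cV[R]_n) : R := Num.sqrt (\sum_i x i 0 ^+ 2).

Definition opnorm n (A : 'M[R]_n) : R :=
  sup [set enorm (A *m x) | x in [set x | enorm x <= 1]].

Definition decay_rate n (S : R -> 'M[R]_n) : \bar R :=
  (- limf_esup (fun t : R => (ln (opnorm (Phi S t)) / t)%:E) +oo%R)%E.

Definition worst_rate (a b T : R) n : \bar R :=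
  ereal_inf [set decay_rate S | S in @Sym_PE n a b T].

Definition worst_rate_rank_le1 (a b T : R) n : \bar R :=
  ereal_inf [set decay_rate S | S in @Sym_PE n a b T `&` @rank_le1 n].

End defs.

(* Main.v *)
(** The fundamental matrix of [x' = - S x] is bounded from below through the
    adjoint equation: if [p' = S p] then [p^T M] is constant for every solution
    [M] of [M' = - S M], so [|M t| >= |p 0| / |p t|].  Any curve [p] whose norm
    increases solves the adjoint equation for the rank one matrix
    [S = p' p'^T / (p . p')], so it is enough to choose a good planar curve.

    Write [p = e^L (cos phi, sin phi)].  During one period the angle [phi] goes
    from [- eps] to [eps] and back while [L' = d^2 |phi'|], so that [log |p|]
    grows by [4 eps d^2].  During the remaining half period [p] rests and [S]
    excites the directions orthogonal to the plane, at no cost.  The integral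
    of [S] over a period is diagonal, and its two planar entries are
    [2 (d^2 (eps + sc) + d^-2 (eps - sc))] and
    [2 (d^2 (eps - sc) + d^-2 (eps + sc))] with [sc = sin eps * cos eps].
    When [a << b], the small amplitude [eps ~ sqrt (a / b)] with
    [d^2 ~ eps / b] puts these entries between [a] and [b] and gives the rate
    [4 eps d^2 / T ~ a / (b^2 T)]. *)
Require Import Defs.
From mathcomp Require Import all_boot all_order all_algebra.
From mathcomp Require Import all_classical all_reals all_analysis.
From mathcomp Require Import ring lra.
Import Order.TTheory GRing.Theory Num.Theory.
Import numFieldNormedType.Exports.
Local Open Scope classical_set_scope.
Local Open Scope ring_scope.
Set Implicit Arguments.
Unset Strict Implicit.

(** * Calculus on the real line *)

Section calculus.
Context {R : realType}.
Local Notation mu := (@lebesgue_measure R).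
Implicit Types (f F : R -> R) (s t u x T : R).

Lemma continuous_itv_integrable f s t :
  continuous f -> mu.-integrable `[s, t] (EFin \o f).
Proof.
move=> cf; apply: continuous_compact_integrable; first exact: segment_compact.
exact: continuous_subspaceT.
Qed.

Lemma Rintegral_FTC2 f F s t : s < t -> continuous f -> continuous F ->
    {in `]s, t[, forall x, is_derive x (1 : R) F (f x)} ->
  \int[mu]_(x in `[s, t]) f x = F t - F s.
Proof.
move=> st cf cF dF.
rewrite /Rintegral (@continuous_FTC2 _ f F)//.
- exact: continuous_subspaceT.
- split.
  + by move=> x /dF -[].
  + exact/cvg_at_right_filter/cF.
  + exact/cvg_at_left_filter/cF.
- by move=> x /dF dFx; rewrite derive1E; apply: derive_val.
Qed.

Lemma Rintegral_itv_split f s t u : s <= t -> t <= u -> continuous f ->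
  \int[mu]_(x in `[s, u]) f x =
    \int[mu]_(x in `[s, t]) f x + \int[mu]_(x in `[t, u]) f x.
Proof.
move=> st tu cf.
rewrite -(@Rintegral_itv_obnd_cbnd _ t (BRight u)); last first.
  apply: (integrableS _ _ _ (@continuous_itv_integrable _ t u cf)) => //.
  by apply: subset_itvr; rewrite bnd_simp.
rewrite -(@Rintegral_itvB _ f (BLeft s) (BRight u) t) ?bnd_simp//; last first.
  exact: continuous_itv_integrable.
by rewrite addrC subrK.
Qed.

Lemma is_derive_Rintegral f s x : s < x -> continuous f ->
  is_derive x (1 : R) (fun y => \int[mu]_(u in `[s, y]) f u) (f x).
Proof.
move=> sx cf.
have xx1 : x < x + 1 by rewrite ltrDl.
have fi := @continuous_itv_integrable f s (x + 1) cf.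
have [dF fE] := continuous_FTC1_closed xx1 fi sx (cf x).
by split; [exact: dF|rewrite -fE derive1E].
Qed.

Lemma is_derive_continuous f x (df : R) :
  is_derive x (1 : R) f df -> {for x, continuous f}.
Proof. by move=> [/derivable1_diffP/differentiable_continuous]. Qed.

Lemma derive0_itv_eq F s t : s <= t -> {within `[s, t], continuous F} ->
    {in `]s, t[, forall x, is_derive x (1 : R) F 0} ->
  F t = F s.
Proof.
move=> st cF dF; have [x _] := @MVT_segment _ F (fun=> 0) _ _ st dF cF.
by rewrite mul0r => /subr0_eq.
Qed.

(** Differentiating the integral over the sliding window [[y, y + T]] in [y] gives
    [f (y + T) - f y], which is zero by periodicity. *)
Lemma Rintegral_periodic f s t T : 0 < T -> continuous f -> periodic f T ->
  \int[mu]_(x in `[t, t + T]) f x = \int[mu]_(x in `[s, s + T]) f x.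
Proof.
move=> T0 cf pf; wlog st : s t / s <= t.
  by move=> h; have [/h//|/ltW/h->] := leP s t.
(* The primitive starts at [s - 1] because [is_derive_Rintegral] needs a point strictly to the right
   of the base point, and regularity is also wanted at [y = s]. *)
pose G y := \int[mu]_(x in `[s - 1, y]) f x.
have GE y : s <= y -> \int[mu]_(x in `[y, y + T]) f x = G (y + T) - G y.
  move=> sy; rewrite /G (@Rintegral_itv_split f (s - 1) y (y + T))//.
  - by rewrite addrAC subrr add0r.
  - lra.
  - lra.
rewrite !GE//.
have dG x : s - 1 < x -> is_derive x (1 : R) (fun y => G (y + T) - G y) 0.
  move=> sx.
  have d1 : is_derive x (1 : R) G (f x) by exact: is_derive_Rintegral.
  have d2 : is_derive (x + T) (1 : R) G (f (x + T)).
    by apply: is_derive_Rintegral => //; lra.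
  have d3 : is_derive x (1 : R) (fun y => y + T) 1.
    by apply: is_derive_eq; rewrite addr0.
  have d4 : is_derive x (1 : R) (G \o (fun y => y + T)) (f (x + T) * 1).
    exact: is_derive1_comp.
  have := @is_deriveB _ _ _ _ _ x 1 _ _ d4 d1.
  by rewrite mulr1 pf subrr.
apply: (@derive0_itv_eq (fun y => G (y + T) - G y)) => //.
- apply: continuous_in_subspaceT => x; rewrite inE/= in_itv/= => /andP[sx _].
  by apply/is_derive_continuous/dG; lra.
- by move=> x; rewrite in_itv/= => /andP[sx _]; apply: dG; lra.
Qed.

End calculus.

(** * Elementary derivatives and the positive part *)

Section real_functions.
Context {R : realType}.

Lemma continuous_max0 (f : R -> R) : continuous f ->
  continuous (fun x => Num.max 0 (f x)).
Proof.
move=> cf x; apply: (@continuous_max _ _ (cst 0) f); first exact: cst_continuous.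
exact: cf.
Qed.

Lemma continuous_comp_fun (f g : R -> R) : continuous g -> continuous f ->
  continuous (fun x => f (g x)).
Proof. by move=> cg cf x; apply: continuous_comp; [exact: cg|exact: cf]. Qed.

(** Squaring removes the corner of the positive part. This makes [angle] differentiable at the
    instants when the rest begins and ends. *)
Lemma is_derive_sqr_max0 (x : R) :
  is_derive x (1 : R) (fun y => Num.max 0 y ^+ 2) (2 * Num.max 0 x).
Proof.
have [x0|x0|->] := ltgtP x 0.
- rewrite mulr0; apply: (near_eq_is_derive _ (is_derive_cst (0 : R) x (1 : R))).
  near=> y; have y0 : y < 0 by near: y; exact: lt_nbhsl.
  by rewrite max_l ?ltW// expr0n.
- have d1 : is_derive x (1 : R) (fun y => y ^+ 2) (2 * x).
    by apply: is_derive_eq; rewrite /GRing.scale/= !mulr1 -mulr2n mulr_natl.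
  apply: (near_eq_is_derive _ d1).
  near=> y; have y0 : 0 < y by near: y; exact: lt_nbhsr.
  by rewrite max_r// ltW.
(* At the corner, [Num.max 0 y ^+ 2 = Num.max 0 y * y], so the positive part itself serves as the
   continuous slope function. *)
- rewrite mulr0; apply/is_derive1_caratheodory.
  exists (fun y => Num.max 0 y); split.
  + move=> y; rewrite maxxx expr0n/= !subr0 expr2.
    by have [y0|y0] := ltP 0 y; rewrite ?mul0r.
  + by apply: continuous_max0 => y; exact: cvg_id.
  + by rewrite maxxx.
Unshelve. all: by end_near. Qed.

Lemma is_deriveD_fun (f g : R -> R) (x df dg : R) :
  is_derive x (1 : R) f df -> is_derive x (1 : R) g dg ->
  is_derive x (1 : R) (fun y => f y + g y) (df + dg).
Proof. exact: is_deriveD. Qed.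

Lemma is_deriveM_fun (f g : R -> R) (x df dg : R) :
  is_derive x (1 : R) f df -> is_derive x (1 : R) g dg ->
  is_derive x (1 : R) (fun y => f y * g y) (f x * dg + g x * df).
Proof. exact: is_deriveM. Qed.

Lemma is_derive_comp_fun (f g : R -> R) (x df dg : R) :
  is_derive (g x) (1 : R) f df -> is_derive x (1 : R) g dg ->
  is_derive x (1 : R) (fun y => f (g y)) (df * dg).
Proof. exact: is_derive1_comp. Qed.


Lemma is_derive_mul_sin_cos x :
  is_derive x (1 : R) (fun x => sin x * cos x) (cos x ^+ 2 - sin x ^+ 2).
Proof. by apply: is_derive_eq; rewrite /GRing.scale/=; ring. Qed.

Lemma is_derive_add_sin_cos x :
  is_derive x (1 : R) (fun x => x + sin x * cos x) (2 * cos x ^+ 2).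
Proof.
have d1 := is_derive_mul_sin_cos x; apply: is_derive_eq.
by rewrite -[X in X + _](cos2Dsin2 x); ring.
Qed.

Lemma is_derive_sub_sin_cos x :
  is_derive x (1 : R) (fun x => x - sin x * cos x) (2 * sin x ^+ 2).
Proof.
have d1 := is_derive_mul_sin_cos x; apply: is_derive_eq.
by rewrite -[X in X - _](cos2Dsin2 x); ring.
Qed.

Lemma is_derive_sqr_sin x :
  is_derive x (1 : R) (fun x => sin x ^+ 2) (2 * (sin x * cos x)).
Proof. by apply: is_derive_eq; rewrite /GRing.scale/=; ring. Qed.

Lemma sin_natpi k : sin (k%:R * pi) = 0 :> R.
Proof.
elim: k => [|k IH]; first by rewrite mul0r sin0.
by rewrite -natr1 mulrDl mul1r sinDpi IH oppr0.
Qed.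

End real_functions.

(** * Fundamental solutions and the adjoint equation *)

Section fundamental.
Context {R : realType}.
Local Notation mu := (@lebesgue_measure R).

Lemma cvg_sumR (F : set_system R) n (f : 'I_n -> R -> R) (a : 'I_n -> R) :
    Filter F -> (forall i, f i x @[x --> F] --> a i) ->
  \sum_i f i x @[x --> F] --> \sum_i a i.
Proof.
move=> FF fa.
by apply: (@cvg_big _ _ +%R 0 xpredT _) => //; exact: add_continuous.
Qed.

Section solution.
Context n (S M : R -> 'M[R]_n).
Hypothesis cS : forall i j, continuous (fun t => S t i j).
Hypothesis fM : fundamental_solution S M.

Lemma fundamental_solution0 : M 0 = 1%:M.
Proof.
case: fM => _ /(_ 0 (lexx 0)) ->; apply/matrixP => i j; rewrite !mxE.
by rewrite set_itv1 Rintegral_set1 subr0.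
Qed.

(** Continuity is relative to [[0, A]], since the integral equation says nothing of [M] at negative
    times; there [M] coincides with an indefinite integral. *)
Lemma fundamental_solution_within_continuous i j A : 0 < A ->
  {within `[0, A], continuous (fun t => M t i j)}.
Proof.
move=> A0; case: fM => iSM ME.
apply: (@subspace_eq_continuous _ `[0, A] _ (fun t => (i == j)%:R -
    \int[mu]_(u in `[0, t]) (S u *m M u) i j)).
  move=> t; rewrite inE/= in_itv/= /from_subspace => /andP[t0 _].
  by rewrite [in RHS]ME// !mxE.
move=> t; apply: cvgB; first exact: cvg_cst.
exact: (parameterized_integral_continuous (ltW A0) (iSM A i j)).
Qed.

Lemma fundamental_solution_continuous i j (t : R) : 0 < t ->
  {for t, continuous (fun t => M t i j)}.
Proof.
move=> t0; have t10 : 0 < t + 1 by lra.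
apply: (within_continuous_continuous t10); last by rewrite in_itv/=; lra.
exact: fundamental_solution_within_continuous.
Qed.

(** A bootstrap: [M] is continuous as an integral, hence so is the integrand [S M] at [t], and the
    fundamental theorem of calculus makes [M] differentiable there. *)
Lemma is_derive_fundamental_solution i j (t : R) : 0 < t ->
  is_derive t (1 : R) (fun t => M t i j) (- \sum_k S t i k * M t k j).
Proof.
move=> t0; case: fM => iSM ME.
have ct : {for t, continuous (fun u => (S u *m M u) i j)}.
  rewrite /prop_for /continuous_at.
  under eq_fun do rewrite mxE.
  rewrite mxE; apply: cvg_sumR => k.
  by apply: cvgM; [exact: cS|exact: fundamental_solution_continuous].
have tt1 : t < t + 1 by rewrite ltrDl.
have [dF fE] := continuous_FTC1_closed tt1 (iSM (t + 1) i j) t0 ct.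
have d1 : is_derive t (1 : R) (fun t => \int[mu]_(u in `[0, t]) (S u *m M u) i j)
    (\sum_k S t i k * M t k j).
  by split; [exact: dF|rewrite -derive1E fE mxE].
have := @is_deriveB _ _ _ _ _ t 1 _ _ (is_derive_cst ((i == j)%:R : R) t 1) d1.
rewrite sub0r; apply: near_eq_is_derive; near=> u.
have u0 : 0 < u by near: u; exact: lt_nbhsr.
by rewrite [in RHS]ME ?ltW// !mxE.
Unshelve. all: by end_near. Qed.

(** The derivative of [p^T M] is [(S^T p)^T M - p^T (S M) = 0] at positive times; continuity on the
    closed interval carries the value back to time 0, where [M] is the identity. *)
Lemma adjoint_solution_invariant (p : R -> 'cV[R]_n) (t : R) : 0 <= t ->
    (forall i (u : R), 0 <= u ->
      is_derive u (1 : R) (fun u => p u i 0) (\sum_k S u k i * p u k 0)) ->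
  (p t)^T *m M t = (p 0)^T.
Proof.
rewrite le_eqVlt => /predU1P[<- _|t0 dp].
  by rewrite fundamental_solution0 mulmx1.
apply/matrixP => i j; rewrite (ord1 i){i}.
rewrite -[RHS](_ : ((p 0)^T *m M 0) 0 j = _); last first.
  by rewrite fundamental_solution0 mulmx1.
rewrite !mxE; under eq_bigr do rewrite mxE; under [RHS]eq_bigr do rewrite mxE.
apply: (@derive0_itv_eq _ (fun u => \sum_i p u i 0 * M u i j)); first exact: ltW.
- apply/subspace_continuousP => u u0t; apply: cvg_sumR => i; apply: cvgM.
    apply: cvg_within_filter.
    move: u0t; rewrite /= in_itv/= => /andP[/(dp i) + _].
    exact: is_derive_continuous.
  move: u u0t; apply/subspace_continuousP.
  exact: fundamental_solution_within_continuous.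
- move=> u; rewrite in_itv/= => /andP[u0 _].
  have d i : is_derive u (1 : R) (fun u => p u i 0 * M u i j)
      (p u i 0 *: (- \sum_k S u i k * M u k j) +
       M u i j *: (\sum_k S u k i * p u k 0)).
    apply: is_deriveM; first exact/dp/ltW.
    exact: is_derive_fundamental_solution.
  have := @is_derive_sum _ _ _ _ _ u 1 _ d.
  rewrite fct_sumE.
  rewrite big_split/= -[X in is_derive _ _ _ X -> _]/(_ + _).
  rewrite (_ : _ + _ = 0)//.
  under eq_bigr do rewrite scalerN /GRing.scale/= mulr_sumr.
  under [X in _ + X]eq_bigr do rewrite /GRing.scale/= mulr_sumr.
  rewrite sumrN exchange_big/= addrC; apply/eqP; rewrite subr_eq0; apply/eqP.
  by apply: eq_bigr => k _; apply: eq_bigr => l _; ring.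
Qed.

End solution.
End fundamental.

(** * Euclidean norm, operator norm and duality *)

Section norms.
Context {R : realType} {n : nat}.
Implicit Types (A : 'M[R]_n) (x y : 'cV[R]_n).

Lemma enorm_ge0 x : 0 <= enorm x.
Proof. exact: sqrtr_ge0. Qed.

Lemma sqr_enorm x : enorm x ^+ 2 = \sum_i x i 0 ^+ 2.
Proof. by rewrite sqr_sqrtr// sumr_ge0// => i _; exact: sqr_ge0. Qed.

Lemma enormZ a x : enorm (a *: x) = `|a| * enorm x.
Proof.
rewrite /enorm -sqrtr_sqr -sqrtrM ?sqr_ge0//; congr Num.sqrt.
by rewrite mulr_sumr; apply: eq_bigr => i _; rewrite mxE exprMn.
Qed.

Lemma coord_le_enorm x i : `|x i 0| <= enorm x.
Proof.
rewrite -sqrtr_sqr ler_sqrt; last by apply: sumr_ge0 => j _; exact: sqr_ge0.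
by rewrite (bigD1 i)//= lerDl sumr_ge0// => j _; exact: sqr_ge0.
Qed.

Lemma cauchy_schwarz x y : (x^T *m y) 0 0 <= enorm x * enorm y.
Proof.
apply: le_trans (ler_norm _) _.
rewrite -(@ler_pXn2r _ 2)// ?nnegrE ?normr_ge0 ?mulr_ge0 ?enorm_ge0//.
rewrite exprMn !sqr_enorm real_normK ?num_real// -subr_ge0.
rewrite -(@pmulr_rge0 _ 2)// mxE; under [X in _ - X ^+ 2]eq_bigr do rewrite mxE.
(* Lagrange's identity, doubled so that the sum runs over all ordered pairs [(i, j)]. *)
have -> : 2 * ((\sum_i x i 0 ^+ 2) * (\sum_i y i 0 ^+ 2) -
    (\sum_i x i 0 * y i 0) ^+ 2) =
    \sum_i \sum_j (x i 0 * y j 0 - x j 0 * y i 0) ^+ 2.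
  transitivity (\sum_i \sum_j (x i 0 ^+ 2 * y j 0 ^+ 2 + x j 0 ^+ 2 * y i 0 ^+ 2
      - 2 * (x i 0 * y i 0 * (x j 0 * y j 0)))); last first.
    by apply: eq_bigr => i _; apply: eq_bigr => j _; ring.
  under [RHS]eq_bigr do rewrite big_split/= sumrN big_split/= -!mulr_sumr.
  rewrite big_split/= sumrN big_split/= -mulr_suml -mulr_sumr.
  under [X in _ + X - _]eq_bigr do rewrite -mulr_suml.
  by rewrite -mulr_sumr -mulr_suml; ring.
by apply: sumr_ge0 => i _; apply: sumr_ge0 => j _; exact: sqr_ge0.
Qed.

Lemma opnorm_ge A x : enorm x <= 1 -> enorm (A *m x) <= opnorm A.
Proof.
move=> x1; apply: ub_le_sup; last by exists x.
(* The set must have an upper bound for [sup] to dominate its elements. The coordinates of [y] are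
   at most 1 in absolute value, so the absolute row sums of [A] provide one. *)
exists (Num.sqrt (\sum_i (\sum_j `|A i j|) ^+ 2)) => _ [y/= y1 <-].
rewrite ler_sqrt; last by apply: sumr_ge0 => j _; exact: sqr_ge0.
apply: ler_sum => i _; rewrite -real_normK ?num_real//.
rewrite ler_pXn2r// ?nnegrE// ?sumr_ge0//.
rewrite mxE (le_trans (ler_norm_sum _ _ _))//; apply: ler_sum => j _.
by rewrite normrM ler_piMr// (le_trans (coord_le_enorm _ _)).
Qed.

(** Test [A] on the unit vector [e] along [x]: then [y^T A e = x^T e] is the norm of [x], and
    Cauchy-Schwarz bounds it by the norm of [y] times that of [A e]. *)
Lemma opnorm_dual_ge A x y : 0 < enorm x -> 0 < enorm y ->
  y^T *m A = x^T -> enorm x / enorm y <= opnorm A.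
Proof.
move=> x0 y0 yA; pose e := (enorm x)^-1 *: x.
have e1 : enorm e = 1.
  by rewrite enormZ ger0_norm ?invr_ge0 ?enorm_ge0// mulVf// gt_eqF.
apply: le_trans (opnorm_ge A (x := e) _); last by rewrite e1.
rewrite ler_pdivrMr// mulrC; apply: le_trans (cauchy_schwarz _ _).
rewrite mulmxA yA -scalemxAr mxE mxE.
under eq_bigr do rewrite mxE -expr2.
by rewrite -sqr_enorm expr2 mulKf ?gt_eqF.
Qed.

Lemma qform_diag_mx (g : 'rV[R]_n) x :
  qform (diag_mx g) x = \sum_i g 0 i * x i 0 ^+ 2.
Proof.
rewrite /qform -mulmxA mul_diag_mx mxE.
by apply: eq_bigr => i _; rewrite !mxE mulrCA expr2.
Qed.

End norms.

(** * From growth of an adjoint solution to a bound on the decay rate *)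

Section decay.
Context {R : realType} {n : nat}.

(** A limsup is bounded from below along any sequence tending to infinity, so the norm of [p] only
    has to be known at the multiples of [T]. *)
Lemma decay_rate_le (S : R -> 'M[R]_n) (p : R -> 'cV[R]_n) (r T : R) :
    0 < T -> 0 <= r ->
    (forall i j, continuous (fun t => S t i j)) ->
    (forall i (u : R), 0 <= u ->
      is_derive u (1 : R) (fun u => p u i 0) (\sum_k S u k i * p u k 0)) ->
    0 < enorm (p 0) ->
    (forall k : nat, enorm (p (k%:R * T)) = enorm (p 0) * expR (r * (k%:R * T))) ->
  (decay_rate S <= r%:E)%E.
Proof.
move=> T0 r0 cS dp p0 pk.
have key (k : nat) : expR (- (r * (k%:R * T))) <= opnorm (Phi S (k%:R * T)).
  have kT0 : 0 <= k%:R * T by rewrite mulr_ge0// ltW.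
  (* If there were no solution, [Phi S] would be its default value [1], whose norm
     does not decay: so the existence of solutions is not needed. *)
  have [fM|nfM] := pselect (exists M, fundamental_solution S M).
    have fPhi : fundamental_solution S (Phi S) by exact: xgetPex.
    have pkT0 : 0 < enorm (p (k%:R * T)) by rewrite pk mulr_gt0 ?expR_gt0.
    have := opnorm_dual_ge p0 pkT0 (adjoint_solution_invariant cS fPhi kT0 dp).
    by rewrite pk invfM mulVKf ?gt_eqF// -expRN.
  have -> : Phi S = fun=> 1%:M.
    by apply: xgetPN => M fM; apply: nfM; exists M.
  have := @opnorm_dual_ge _ _ 1%:M _ _ p0 p0 (mulmx1 _).
  rewrite divff ?gt_eqF// => /(le_trans _); apply.
  by rewrite -[leRHS]expR0 ler_expR oppr_le0 mulr_ge0.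
rewrite /decay_rate leeNl limf_esupE; apply: le_ereal_inf_tmp => _ [V VF <-].
(* The limsup is an infimum over neighbourhoods [V] of infinity of suprema over [V]; it is enough to
   find in each [V] one positive multiple of [T]. *)
have [A [_ AV]] : \forall x \near +oo%R, V x by [].
pose k := (Num.truncn (Num.max (A / T) 1)).+1.
have Ak : A < k%:R * T.
  rewrite -ltr_pdivrMr//; apply: le_lt_trans (truncnS_gt _).
  by rewrite le_max lexx.
have kT0 : 0 < k%:R * T by rewrite mulr_gt0.
apply: (@le_trans _ _ ((ln (opnorm (Phi S (k%:R * T))) / (k%:R * T))%:E)).
  rewrite -EFinN lee_fin ler_pdivlMr// mulNr -[leLHS]expRK ler_ln//.
  - by rewrite posrE expR_gt0.
  - by rewrite posrE (lt_le_trans (expR_gt0 _) (key k)).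
by apply: ereal_sup_ubound; exists (k%:R * T) => //; exact: AV.
Qed.

End decay.

(** * A slowly growing curve and its rank one matrix *)

Section curve.
Context {R : realType}.
Local Notation mu := (@lebesgue_measure R).
Context (T eps d a : R).
Hypotheses (T0 : 0 < T) (eps0 : 0 < eps) (d0 : 0 < d) (a0 : 0 < a).

Let om : R := 2 * pi / T.
(** While [cos (om * t)] is nonnegative this is [eps * cos (2 * om * t)]; during the other half of
    the period the positive part freezes the angle at [- eps]. *)
Definition angle t : R := eps * (2 * Num.max 0 (cos (om * t)) ^+ 2 - 1).
Definition speed t : R :=
  - (4 * eps * om) * (Num.max 0 (cos (om * t)) * sin (om * t)).
(* At most one of [rising], [falling] and [resting] is nonzero at a given time,
   so that products of coefficients have no cross terms. *)
Definition rising t : R := Num.sqrt (Num.max 0 (speed t)).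
Definition falling t : R := Num.sqrt (Num.max 0 (- speed t)).
Definition resting t : R := Num.sqrt (a * (om * Num.max 0 (- cos (om * t)))).

(* With [e] the unit vector of angle [x] and [e'] its derivative, the planar part
   of the vector [c] such that [S = c c^T] is proportional to [p'], i.e. to
   [d e + d^-1 e'] when the angle increases and to [d e - d^-1 e'] when it
   decreases. *)
Definition rising_profile (i : nat) x : R :=
  match i with
  | 0 => d * cos x - d^-1 * sin x
  | 1 => d * sin x + d^-1 * cos x
  | _ => 0
  end.

Definition falling_profile (i : nat) x : R :=
  match i with
  | 0 => d * cos x + d^-1 * sin x
  | 1 => d * sin x - d^-1 * cos x
  | _ => 0
  end.

(* Evaluated at [x = sin (om * t)], which runs monotonically over [[-1, 1]] during
   the rest: these cosines are orthonormal there. *)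
Definition resting_profile (i : nat) x : R :=
  match i with
  | 0 | 1 => 0
  | k.+2 => cos (k.+1%:R * pi * x)
  end.

Definition coef (i : nat) t : R :=
  rising t * rising_profile i (angle t) +
  falling t * falling_profile i (angle t) +
  resting t * resting_profile i (sin (om * t)).

(** * Regularity, periodicity and products of the coefficients *)

Lemma om_gt0 : 0 < om.
Proof. by rewrite !mulr_gt0 ?invr_gt0 ?pi_gt0. Qed.

Lemma continuous_scale : continuous (fun t : R => om * t).
Proof. by move=> t; apply: cvgM; [exact: cvg_cst|exact: cvg_id]. Qed.

Lemma continuous_cos_om : continuous (fun t => cos (om * t)).
Proof. exact: continuous_comp_fun continuous_scale (@continuous_cos R). Qed.

Lemma continuous_sin_om : continuous (fun t => sin (om * t)).
Proof. exact: continuous_comp_fun continuous_scale (@continuous_sin R). Qed.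

Lemma is_derive_angle t : is_derive t (1 : R) angle (speed t).
Proof.
have d1 : is_derive t (1 : R) (fun t => om * t) om.
  by apply: is_derive_eq; rewrite /GRing.scale/= mulr1.
have d2 : is_derive t (1 : R) (fun t => cos (om * t)) (- sin (om * t) * om).
  exact: is_derive_comp_fun.
have d3 := is_derive_comp_fun (is_derive_sqr_max0 (cos (om * t))) d2.
have d4 : is_derive t (1 : R)
    (fun t => eps * (2 * Num.max 0 (cos (om * t)) ^+ 2 - 1))
    (eps * (2 * (2 * Num.max 0 (cos (om * t)) * (- sin (om * t) * om)))).
  apply: is_derive_eq.
  by rewrite /GRing.scale/= subr0.
apply: (is_derive_eq d4); rewrite /speed; ring.
Qed.

Lemma continuous_angle : continuous angle.
Proof. by move=> t; apply: is_derive_continuous (is_derive_angle t). Qed.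

Lemma continuous_speed : continuous speed.
Proof.
move=> t; apply: cvgM; first exact: cvg_cst.
apply: cvgM; last exact: continuous_sin_om.
exact: (continuous_max0 continuous_cos_om).
Qed.

Lemma continuous_coef i : continuous (coef i).
Proof.
have cr : continuous (rising_profile i).
  case: i => [|[|i]] x; last exact: cvg_cst.
  + by apply: cvgB; apply: cvgM; [exact: cvg_cst|exact: continuous_cos|
      exact: cvg_cst|exact: continuous_sin].
  + by apply: cvgD; apply: cvgM; [exact: cvg_cst|exact: continuous_sin|
      exact: cvg_cst|exact: continuous_cos].
have cf : continuous (falling_profile i).
  case: i {cr} => [|[|i]] x; last exact: cvg_cst.
  + by apply: cvgD; apply: cvgM; [exact: cvg_cst|exact: continuous_cos|
      exact: cvg_cst|exact: continuous_sin].
  + by apply: cvgB; apply: cvgM; [exact: cvg_cst|exact: continuous_sin|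
      exact: cvg_cst|exact: continuous_cos].
have cg : continuous (resting_profile i).
  case: i {cr cf} => [|[|i]]; [move=> x; exact: cvg_cst..|].
  apply: continuous_comp_fun (@continuous_cos R) => x.
  by apply: cvgM; [exact: cvg_cst|exact: cvg_id].
have cs := @sqrt_continuous R.
move=> t; apply: cvgD; first apply: cvgD; apply: cvgM; move: t.
- exact: (continuous_comp_fun (continuous_max0 continuous_speed) cs).
- exact: (continuous_comp_fun continuous_angle cr).
- apply: (continuous_comp_fun _ cs); apply: continuous_max0 => t.
  by apply: cvgN; exact: continuous_speed.
- exact: (continuous_comp_fun continuous_angle cf).
- apply: (continuous_comp_fun _ cs) => t.
  apply: cvgM; first exact: cvg_cst.
  apply: cvgM; first exact: cvg_cst.
  move: t; apply: continuous_max0 => t.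
  by apply: cvgN; exact: continuous_cos_om.
- exact: (continuous_comp_fun continuous_sin_om cg).
Qed.

Lemma om_period t : om * (t + T) = om * t + pi *+ 2.
Proof. by rewrite mulrDr /om mulfVK ?gt_eqF// mulr_natl. Qed.

Lemma periodic_angle : periodic angle T.
Proof. by move=> t; rewrite /angle om_period cosD2pi. Qed.

Lemma periodic_speed : periodic speed T.
Proof. by move=> t; rewrite /speed om_period cosD2pi sinD2pi. Qed.

Lemma sqr_rising t : rising t ^+ 2 = Num.max 0 (speed t).
Proof. by rewrite sqr_sqrtr// le_max lexx. Qed.

Lemma sqr_falling t : falling t ^+ 2 = Num.max 0 (- speed t).
Proof. by rewrite sqr_sqrtr// le_max lexx. Qed.

Lemma sqr_resting t : resting t ^+ 2 = a * (om * Num.max 0 (- cos (om * t))).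
Proof.
rewrite sqr_sqrtr//; apply: mulr_ge0; first exact: ltW.
by apply: mulr_ge0; [exact/ltW/om_gt0|rewrite le_max lexx].
Qed.

Lemma speed_eq0 t : cos (om * t) <= 0 -> speed t = 0.
Proof. by move=> c0; rewrite /speed max_l// mul0r mulr0. Qed.

Lemma rising_falling t : rising t * falling t = 0.
Proof.
have [v0|v0] := leP (speed t) 0; rewrite /rising /falling.
  by rewrite max_l// sqrtr0 mul0r.
by rewrite [X in _ * Num.sqrt X]max_l ?sqrtr0 ?mulr0// oppr_le0 ltW.
Qed.

Lemma rising_resting t : rising t * resting t = 0.
Proof.
have [c0|c0] := leP (cos (om * t)) 0; rewrite /rising /resting.
  by rewrite speed_eq0// maxxx sqrtr0 mul0r.
by rewrite [X in _ * Num.sqrt (_ * (_ * X))]max_l ?mulr0 ?sqrtr0 ?mulr0// oppr_le0 ltW.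
Qed.

Lemma falling_resting t : falling t * resting t = 0.
Proof.
have [c0|c0] := leP (cos (om * t)) 0; rewrite /falling /resting.
  by rewrite speed_eq0// oppr0 maxxx sqrtr0 mul0r.
by rewrite [X in _ * Num.sqrt (_ * (_ * X))]max_l ?mulr0 ?sqrtr0 ?mulr0// oppr_le0 ltW.
Qed.

Lemma coefM i j t : coef i t * coef j t =
  Num.max 0 (speed t) * (rising_profile i (angle t) * rising_profile j (angle t)) +
  Num.max 0 (- speed t) * (falling_profile i (angle t) * falling_profile j (angle t)) +
  a * (om * Num.max 0 (- cos (om * t))) *
    (resting_profile i (sin (om * t)) * resting_profile j (sin (om * t))).
Proof.
rewrite -sqr_rising -sqr_falling -sqr_resting /coef.
have := rising_falling t; have := rising_resting t; have := falling_resting t.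
move: (rising t) (falling t) (resting t) => r f g fg rg rf.
apply/eqP; rewrite -subr_eq0; apply/eqP.
set x1 := rising_profile i _; set x2 := falling_profile i _.
set x3 := resting_profile i _; set y1 := rising_profile j _.
set y2 := falling_profile j _; set y3 := resting_profile j _.
transitivity (r * f * (x1 * y2 + x2 * y1) + r * g * (x1 * y3 + x3 * y1) +
   f * g * (x2 * y3 + x3 * y2)); first by ring.
by rewrite rf rg fg !mul0r !addr0.
Qed.


(** * Signs over one period and integration over a window *)

Lemma om_quarter : om * (T / 4) = pi / 2.
Proof. by rewrite /om; field; rewrite gt_eqF. Qed.

Lemma angle_quarter : angle (T / 4) = - eps.
Proof. by rewrite /angle om_quarter cos_pihalf maxxx; ring. Qed.

Lemma angle_quarterN : angle (- (T / 4)) = - eps.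
Proof. by rewrite /angle mulrN cosN om_quarter cos_pihalf maxxx; ring. Qed.

Lemma angle0 : angle 0 = eps.
Proof. by rewrite /angle mulr0 cos0 max_r//; ring. Qed.

Lemma sin_om_quarter : sin (om * (T / 4)) = 1.
Proof. by rewrite om_quarter sin_pihalf. Qed.

Lemma sin_om_three_quarters : sin (om * (3 * T / 4)) = - 1.
Proof.
rewrite (_ : 3 * T / 4 = - (T / 4) + T); last by field.
by rewrite om_period sinD2pi mulrN sinN sin_om_quarter.
Qed.

Lemma om_itv s u x : x \in `]s, u[ -> om * s < om * x < om * u.
Proof. by rewrite in_itv/= !ltr_pM2l ?om_gt0. Qed.

Lemma speed_ge0 x : x \in `]- (T / 4), 0[ -> 0 <= cos (om * x) /\ 0 <= speed x.
Proof.
move=> /om_itv; rewrite mulr0 mulrN om_quarter => /andP[l r].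
have c0 : 0 <= cos (om * x).
  by apply: cos_ge0_pihalf; rewrite ltW//= ltW// (lt_le_trans r)// divr_ge0 ?pi_ge0.
split=> //; rewrite /speed max_r// mulNr -mulrN mulr_ge0//.
  by apply: mulr_ge0; [apply: mulr_ge0 => //; exact: ltW|exact/ltW/om_gt0].
rewrite -mulrN mulr_ge0// -sinN; apply: sin_ge0_pi.
have := pi_ge0 R; lra.
Qed.

Lemma speed_le0 x : x \in `]0, T / 4[ -> 0 <= cos (om * x) /\ speed x <= 0.
Proof.
move=> /om_itv; rewrite mulr0 om_quarter => /andP[l r].
have pi0 := pi_ge0 R.
have c0 : 0 <= cos (om * x) by apply: cos_ge0_pihalf; lra.
split=> //; rewrite /speed max_r// mulNr oppr_le0 mulr_ge0//.
  by apply: mulr_ge0; [apply: mulr_ge0 => //; exact: ltW|exact/ltW/om_gt0].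
by rewrite mulr_ge0//; apply: sin_ge0_pi; lra.
Qed.

Lemma cos_om_le0 x : x \in `]T / 4, 3 * T / 4[ -> cos (om * x) <= 0.
Proof.
move=> /om_itv; rewrite om_quarter.
rewrite (_ : 3 * T / 4 = 3 * (T / 4)); last by field.
rewrite mulrCA om_quarter => /andP[l r].
rewrite -[om * x](subrK pi) cosDpi oppr_le0; apply: cos_ge0_pihalf; lra.
Qed.

(* The period is cut at [- T / 4], [0], [T / 4] and [3 T / 4], between which the
   signs of [speed] and of [cos (om * t)] are constant. *)
Lemma Rintegral_window f (A1 A2 A3 B1 B2 B3 : R -> R) t : continuous f ->
    (forall x, f x = Num.max 0 (speed x) * B1 (angle x) +
      Num.max 0 (- speed x) * B2 (angle x) +
      a * (om * Num.max 0 (- cos (om * x))) * B3 (sin (om * x))) ->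
    (forall x, is_derive x (1 : R) A1 (B1 x)) ->
    (forall x, is_derive x (1 : R) A2 (B2 x)) ->
    (forall x, is_derive x (1 : R) A3 (B3 x)) ->
  \int[mu]_(x in `[t, t + T]) f x = (A1 eps - A1 (- eps)) +
    (A2 eps - A2 (- eps)) + a * (A3 1 - A3 (- 1)).
Proof.
move=> cf fE dA1 dA2 dA3.
have l1 : - (T / 4) < 0 by have := T0; lra.
have l2 : 0 < T / 4 by have := T0; lra.
have l3 : T / 4 < 3 * T / 4 by have := T0; lra.
have pf : periodic f T.
  by move=> x; rewrite !fE periodic_speed periodic_angle om_period cosD2pi sinD2pi.
rewrite (@Rintegral_periodic _ f (- (T / 4)) t T)//.
have -> : - (T / 4) + T = 3 * T / 4 by field.
rewrite (@Rintegral_itv_split _ f _ 0) ?(ltW l1)//; last exact: ltW (lt_trans l2 l3).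
rewrite (@Rintegral_itv_split _ f _ (T / 4) (3 * T / 4)) ?(ltW l2) ?(ltW l3)//.
(* Three changes of variable: the angle runs from [- eps] to [eps] on the first piece and back on
   the second, and [sin (om * x)] runs from 1 to -1 on the third. The minus signs in [d2] and [d3]
   account for the decreasing variables. *)
have d1 x : is_derive x (1 : R) (fun x => A1 (angle x)) (B1 (angle x) * speed x).
  by apply: is_derive_comp_fun; exact: is_derive_angle.
have d2 x : is_derive x (1 : R) (fun x => - A2 (angle x)) (- (B2 (angle x) * speed x)).
  apply: is_deriveN; apply: is_derive_comp_fun; exact: is_derive_angle.
have d3 x : is_derive x (1 : R) (fun x => - (a * A3 (sin (om * x))))
    (- (a * (B3 (sin (om * x)) * (cos (om * x) * om)))).
  apply: is_deriveN; apply: (@is_deriveZ _ _ _ (fun x => A3 (sin (om * x))) a).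
  apply: is_derive_comp_fun; apply: is_derive_comp_fun.
  by apply: is_derive_eq; rewrite /GRing.scale/= mulr1.
rewrite (@Rintegral_FTC2 _ f (fun x => A1 (angle x))); [|by []|by []| |]; first last.
- move=> x xI; have [c0 s0] := speed_ge0 xI; apply: (is_derive_eq (d1 x)).
  by rewrite fE max_r// !max_l ?oppr_le0//; ring.
- by move=> x; exact: is_derive_continuous.
rewrite (@Rintegral_FTC2 _ f (fun x => - A2 (angle x))); [|by []|by []| |]; first last.
- move=> x xI; have [c0 s0] := speed_le0 xI; apply: (is_derive_eq (d2 x)).
  by rewrite fE max_l// max_r ?oppr_ge0// max_l ?oppr_le0//; ring.
- by move=> x; exact: is_derive_continuous.
rewrite (@Rintegral_FTC2 _ f (fun x => - (a * A3 (sin (om * x)))));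
  [|by []|by []| |]; first last.
- move=> x xI; have c0 := cos_om_le0 xI; apply: (is_derive_eq (d3 x)).
  by rewrite fE speed_eq0// oppr0 maxxx max_r ?oppr_ge0//; ring.
- by move=> x; exact: is_derive_continuous.
rewrite angle_quarterN angle_quarter angle0 sin_om_quarter sin_om_three_quarters.
by ring.
Qed.


(** * Gram matrix of the coefficients over a window of length [T] *)

Definition gram (i : nat) : R :=
  let sc := sin eps * cos eps in
  match i with
  | 0 => 2 * (d ^+ 2 * (eps + sc) + d ^- 2 * (eps - sc))
  | 1 => 2 * (d ^+ 2 * (eps - sc) + d ^- 2 * (eps + sc))
  | _ => a
  end.

(** The planar directions are excited only while the angle moves and the others only during the
    rest, so the product vanishes pointwise. *)
Lemma Rintegral_coef0 i j t : (i < 2)%N -> (2 <= j)%N ->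
  \int[mu]_(x in `[t, t + T]) (coef i x * coef j x) = 0.
Proof.
case: j => [|[|j]]// i2 _.
rewrite (@Rintegral_window _ (cst 0) (cst 0) (cst 0) (cst 0) (cst 0) (cst 0)).
- by rewrite /cst !subrr mulr0 !addr0.
- by move=> x; apply: cvgM; exact: continuous_coef.
- by move=> x; case: i i2 => [|[|i]]// _; rewrite coefM /= !(mul0r, mulr0).
Qed.


(** The squared weight [resting] is [a] times the absolute derivative of [sin (om * t)] during the
    rest. Substituting [x = sin (om * t)] leaves the orthonormality of the functions
    [cos (k * pi * x)], [k >= 1], on [[-1, 1]]. *)
Lemma Rintegral_coef_resting i j t :
  \int[mu]_(x in `[t, t + T]) (coef i.+2 x * coef j.+2 x) = a *+ (i == j).
Proof.
set u : R := i.+1%:R * pi; set v : R := j.+1%:R * pi.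
have u0 : 0 < u by rewrite mulr_gt0 ?pi_gt0.
have v0 : 0 < v by rewrite mulr_gt0 ?pi_gt0.
have su : sin u = 0 := sin_natpi _; have sv : sin v = 0 := sin_natpi _.
have du (w x : R) : is_derive x (1 : R) (fun x => sin (w * x)) (cos (w * x) * w).
  apply: is_derive_comp_fun.
  by apply: is_derive_eq; rewrite /GRing.scale/= mulr1.
have dv (w x : R) : is_derive x (1 : R) (fun x => cos (w * x)) (- sin (w * x) * w).
  apply: is_derive_comp_fun.
  by apply: is_derive_eq; rewrite /GRing.scale/= mulr1.
(* A primitive of [cos (u * x) * cos (v * x)], with a separate formula for equal frequencies, where
   [u ^+ 2 - v ^+ 2] vanishes. Since [sin u = sin v = 0], only the linear term of the diagonal case
   survives at the endpoints. *)
pose A (x : R) := if i == j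
  then 2^-1 * (x + u^-1 * (sin (u * x) * cos (u * x)))
  else (u ^+ 2 - v ^+ 2)^-1 * (u * (sin (u * x) * cos (v * x)) -
         v * (sin (v * x) * cos (u * x))).
have dA x : is_derive x (1 : R) A (cos (u * x) * cos (v * x)).
  rewrite /A; have [ij|ij] := eqVneq i j.
  + apply: is_derive_eq; rewrite /GRing.scale/= /v -ij -/u.
    rewrite -[X in 2^-1 * (X + _)](cos2Dsin2 (u * x)).
    by field; rewrite gt_eqF.
  + have uv : u ^+ 2 - v ^+ 2 != 0.
      rewrite subr_eq0 eqrXn2 ?ltW//.
      by rewrite (can_eq (mulfK (lt0r_neq0 (pi_gt0 R)))) eqr_nat eqSS.
    by apply: is_derive_eq; rewrite /GRing.scale/=; field.
rewrite (@Rintegral_window _ (cst 0) (cst 0) A (cst 0) (cst 0)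
  (fun x => cos (u * x) * cos (v * x))).
- rewrite /cst !subrr !add0r /A !mulr1 !mulrN1 !sinN !cosN su sv.
  case: eqP => _; rewrite ?mulr1n ?mulr0n !(mul0r, mulr0, oppr0, addr0, subrr)//.
  by field.
- by move=> x; apply: cvgM; exact: continuous_coef.
- by move=> x; rewrite coefM /= !(mul0r, mulr0).
Qed.

Lemma Rintegral_coef00 t :
  \int[mu]_(x in `[t, t + T]) (coef 0 x * coef 0 x) = gram 0.
Proof.
(* The sign [e] is 1 for the rising profile and -1 for the falling one. It multiplies [sin x ^+ 2],
   which is even and contributes nothing between [- eps] and [eps]. *)
pose A (e x : R) := 2^-1 * (d ^+ 2 * (x + sin x * cos x)) +
  2^-1 * (d ^- 2 * (x - sin x * cos x)) - e * sin x ^+ 2.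
have dA e x : is_derive x (1 : R) (A e)
    (d ^+ 2 * cos x ^+ 2 + d ^- 2 * sin x ^+ 2 - e * (2 * (sin x * cos x))).
  have d1 := is_derive_add_sin_cos x; have d2 := is_derive_sub_sin_cos x.
  have d3 := is_derive_sqr_sin x.
  by apply: is_derive_eq; rewrite /GRing.scale/=; field; rewrite gt_eqF.
have dr x : is_derive x (1 : R) (A 1) (rising_profile 0 x * rising_profile 0 x).
  by apply: (is_derive_eq (dA 1 x)) => /=; field; rewrite gt_eqF.
have df x : is_derive x (1 : R) (A (-1)) (falling_profile 0 x * falling_profile 0 x).
  by apply: (is_derive_eq (dA (-1) x)) => /=; field; rewrite gt_eqF.
rewrite (@Rintegral_window _ (A 1) (A (-1)) (cst 0)
  (fun x => rising_profile 0 x * rising_profile 0 x)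
  (fun x => falling_profile 0 x * falling_profile 0 x) (cst 0)).
- by rewrite /A /gram /cst !sinN !cosN; field; rewrite gt_eqF.
- by move=> x; apply: cvgM; exact: continuous_coef.
- by move=> x; rewrite coefM /= mul0r.
Qed.

Lemma Rintegral_coef11 t :
  \int[mu]_(x in `[t, t + T]) (coef 1 x * coef 1 x) = gram 1.
Proof.
pose A (e x : R) := 2^-1 * (d ^+ 2 * (x - sin x * cos x)) +
  2^-1 * (d ^- 2 * (x + sin x * cos x)) + e * sin x ^+ 2.
have dA e x : is_derive x (1 : R) (A e)
    (d ^+ 2 * sin x ^+ 2 + d ^- 2 * cos x ^+ 2 + e * (2 * (sin x * cos x))).
  have d1 := is_derive_add_sin_cos x; have d2 := is_derive_sub_sin_cos x.
  have d3 := is_derive_sqr_sin x.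
  by apply: is_derive_eq; rewrite /GRing.scale/=; field; rewrite gt_eqF.
have dr x : is_derive x (1 : R) (A 1) (rising_profile 1 x * rising_profile 1 x).
  by apply: (is_derive_eq (dA 1 x)) => /=; field; rewrite gt_eqF.
have df x : is_derive x (1 : R) (A (-1)) (falling_profile 1 x * falling_profile 1 x).
  by apply: (is_derive_eq (dA (-1) x)) => /=; field; rewrite gt_eqF.
rewrite (@Rintegral_window _ (A 1) (A (-1)) (cst 0)
  (fun x => rising_profile 1 x * rising_profile 1 x)
  (fun x => falling_profile 1 x * falling_profile 1 x) (cst 0)).
- by rewrite /A /gram /cst !sinN !cosN; field; rewrite gt_eqF.
- by move=> x; apply: cvgM; exact: continuous_coef.
- by move=> x; rewrite coefM /= mul0r.
Qed.

(** The [sin x ^+ 2] part of the primitive is even and vanishes between [- eps] and [eps]; the part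
    in [sin x * cos x] has opposite signs on the way up and on the way down. The return sweep thus
    makes the integral diagonal. *)
Lemma Rintegral_coef01 t :
  \int[mu]_(x in `[t, t + T]) (coef 0 x * coef 1 x) = 0.
Proof.
pose A (e x : R) := (d ^+ 2 - d ^- 2) * (2^-1 * sin x ^+ 2) + e * (sin x * cos x).
have dA e x : is_derive x (1 : R) (A e)
    ((d ^+ 2 - d ^- 2) * (sin x * cos x) + e * (cos x ^+ 2 - sin x ^+ 2)).
  have d1 := is_derive_mul_sin_cos x; have d2 := is_derive_sqr_sin x.
  by apply: is_derive_eq; rewrite /GRing.scale/=; field; rewrite gt_eqF.
have dr x : is_derive x (1 : R) (A 1) (rising_profile 0 x * rising_profile 1 x).
  by apply: (is_derive_eq (dA 1 x)) => /=; field; rewrite gt_eqF.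
have df x : is_derive x (1 : R) (A (-1)) (falling_profile 0 x * falling_profile 1 x).
  by apply: (is_derive_eq (dA (-1) x)) => /=; field; rewrite gt_eqF.
rewrite (@Rintegral_window _ (A 1) (A (-1)) (cst 0)
  (fun x => rising_profile 0 x * rising_profile 1 x)
  (fun x => falling_profile 0 x * falling_profile 1 x) (cst 0)).
- by rewrite /A /cst !sinN !cosN; field; rewrite gt_eqF.
- by move=> x; apply: cvgM; exact: continuous_coef.
- by move=> x; rewrite coefM /= mul0r.
Qed.

Lemma Rintegral_coef i j t :
  \int[mu]_(x in `[t, t + T]) (coef i x * coef j x) = gram i *+ (i == j).
Proof.
wlog ij : i j / (i <= j)%N.
  move=> h; have [/h//|/ltnW ji] := leqP i j.
  under eq_Rintegral do rewrite mulrC.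
  by rewrite h// eq_sym; case: eqP => [->|].
case: i ij => [|[|i]]; case: j => [|[|j]]// _.
- exact: Rintegral_coef00.
- exact: Rintegral_coef01.
- exact: Rintegral_coef0.
- exact: Rintegral_coef11.
- exact: Rintegral_coef0.
- exact: Rintegral_coef_resting.
Qed.

(** This is the total variation of the angle: a range of length [2 * eps], swept twice per
    period. *)
Lemma Rintegral_norm_speed t : \int[mu]_(x in `[t, t + T]) `|speed x| = 4 * eps.
Proof.
rewrite (@Rintegral_window _ id id (cst 0) (cst 1) (cst 1) (cst 0)).
- by rewrite /cst; ring.
- by move=> x; apply: cvg_norm; exact: continuous_speed.
- move=> x; rewrite /cst !mulr1 mulr0 addr0.
  have [x0|x0] := leP 0 (speed x).
    by rewrite ger0_norm// max_l ?oppr_le0// addr0.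
  by rewrite ltr0_norm// max_r ?oppr_ge0 ?ltW// add0r.
Qed.


(** * The rank one matrix, the growing curve and the resulting rate *)

Definition curve_vec n t : 'cV[R]_n := \col_i coef i t.

Definition curve_mx n t : 'M[R]_n := curve_vec n t *m (curve_vec n t)^T.

Lemma curve_mxE n t i j : curve_mx n t i j = coef i t * coef j t.
Proof. by rewrite /curve_mx mxE big_ord1 !mxE. Qed.

Lemma continuous_curve_mx n i j : continuous (fun t => curve_mx n t i j).
Proof.
under eq_fun do rewrite curve_mxE.
by move=> t; apply: cvgM; exact: continuous_coef.
Qed.

Lemma mx_integral_curve_mx n t :
  mx_integral t (t + T) (curve_mx n) = diag_mx (\row_i gram i).
Proof.
apply/matrixP => i j; rewrite !mxE.
by under eq_Rintegral do rewrite curve_mxE; rewrite Rintegral_coef.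
Qed.

Lemma Sym_PE_curve_mx n b :
    (forall i, a <= gram i) -> (forall i, gram i <= b) ->
  Sym_PE a b T (curve_mx n).
Proof.
move=> ag gb; split.
- by move=> t i j; apply: continuous_itv_integrable; exact: continuous_curve_mx.
- move=> t _; split; first by rewrite /curve_mx trmx_mul trmxK.
  move=> x; rewrite /qform mulmx0 mul0mx mxE /curve_mx.
  rewrite mulmxA -mulmxA -[X in X *m (_ *m _)]trmxK trmx_mul trmxK mxE big_ord1 mxE.
  by rewrite -expr2 sqr_ge0.
- move=> t _; rewrite mx_integral_curve_mx -!diag_const_mx.
  by split=> x; rewrite !qform_diag_mx; apply: ler_sum => i _;
    rewrite !mxE ler_wpM2r ?sqr_ge0.
Qed.

(** The base point -1 makes this function differentiable at [t = 0] as well; [curve] subtracts its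
    value at 0. *)
Let log_growth t : R := d ^+ 2 * \int[mu]_(x in `[-1, t]) `|speed x|.

Definition direction (i : nat) x : R :=
  match i with 0 => cos x | 1 => sin x | _ => 0 end.

Definition curve n t : 'cV[R]_n :=
  \col_i (expR (log_growth t - log_growth 0) * direction i (angle t)).

(** With [r] and [f] for [rising] and [falling], the speed is [r ^+ 2 - f ^+ 2] and its absolute
    value [r ^+ 2 + f ^+ 2]. Both sides become polynomials in the coefficients that differ only by
    cross products, all zero. *)
Lemma is_derive_curve n i (t : R) : 0 <= t ->
  is_derive t (1 : R) (fun t => curve n.+2 t i 0)
    (\sum_k curve_mx n.+2 t k i * curve n.+2 t k 0).
Proof.
move=> t0; have t1 : -1 < t by rewrite (lt_le_trans _ t0).
have d1 : is_derive t (1 : R) log_growth (d ^+ 2 * `|speed t|).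
  apply: is_deriveZ; apply: is_derive_Rintegral => // x.
  by apply: cvg_norm; exact: continuous_speed.
pose e : R := expR (log_growth t - log_growth 0).
have d2 : is_derive t (1 : R) (fun t => expR (log_growth t - log_growth 0))
    (e * (d ^+ 2 * `|speed t|)).
  apply: is_derive_comp_fun.
  have := is_deriveD_fun d1 (is_derive_cst (- log_growth 0) t (1 : R)).
  by rewrite addr0.
pose dd (k : nat) x : R := match k with 0 => - sin x | 1 => cos x | _ => 0 end.
have d3 k : is_derive t (1 : R) (fun t => direction k (angle t))
    (dd k (angle t) * speed t).
  apply: is_derive_comp_fun; last exact: is_derive_angle.
  case: k => [|[|k]]; [exact: is_derive_cos|exact: is_derive_sin|].
  exact: is_derive_cst.
under eq_fun do rewrite mxE.
apply: (is_derive_eq (is_deriveM_fun d2 (d3 i))).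
rewrite big_ord_recl big_ord_recl big1 ?addr0; last first.
  by move=> k _; rewrite [X in _ * X]mxE/= !mulr0.
rewrite !curve_mxE ![curve _ _ _ _]mxE/= -/e.
have -> : `|speed t| = rising t ^+ 2 + falling t ^+ 2.
  rewrite sqr_rising sqr_falling; have [s0|s0] := leP 0 (speed t).
    by rewrite ger0_norm// max_l ?oppr_le0// addr0.
  by rewrite ltr0_norm// max_r ?oppr_ge0 ?ltW// add0r.
have -> : speed t = rising t ^+ 2 - falling t ^+ 2.
  rewrite sqr_rising sqr_falling; have [s0|s0] := leP 0 (speed t).
    by rewrite max_l ?oppr_le0// subr0.
  by rewrite max_r ?oppr_ge0 ?ltW// sub0r opprK.
(* The scalar product of the vector [c] with the unit direction of the curve: the components along
   the derivative of that direction drop out. *)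
have H : coef 0 t * cos (angle t) + coef 1 t * sin (angle t) =
    d * (rising t + falling t).
  by rewrite -[RHS]mulr1 -(cos2Dsin2 (angle t)) /coef/=; ring.
transitivity (e * (coef i t * (coef 0 t * cos (angle t) + coef 1 t * sin (angle t))));
  last by ring.
rewrite H; have rf := rising_falling t; have rg := rising_resting t.
have fg := falling_resting t.
move: (nat_of_ord i) => {H}k; rewrite /coef.
move: (rising t) (falling t) (resting t) rf rg fg => r f g rf rg fg.
apply/eqP; rewrite -subr_eq0; apply/eqP; case: k => [|[|k]] /=.
- transitivity (- (2 * e * d ^+ 2 * cos (angle t)) * (r * f)).
    by field; rewrite gt_eqF.
  by rewrite rf mulr0.
- transitivity (- (2 * e * d ^+ 2 * sin (angle t)) * (r * f)).
    by field; rewrite gt_eqF.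
  by rewrite rf mulr0.
- transitivity (- (e * d * cos (k.+1%:R * pi * sin (om * t))) * (r * g + f * g)).
    by ring.
  by rewrite rg fg addr0 mulr0.
Qed.

Lemma enorm_curve n t : enorm (curve n.+2 t) = expR (log_growth t - log_growth 0).
Proof.
rewrite /enorm big_ord_recl big_ord_recl big1 ?addr0 => [|i _]; last first.
  by rewrite mxE/= mulr0 expr0n.
by rewrite !mxE/= !exprMn -mulrDr cos2Dsin2 mulr1 sqrtr_sqr ger0_norm// expR_ge0.
Qed.

Lemma log_growth_period (k : nat) :
  log_growth (k%:R * T) - log_growth 0 = 4 * eps * d ^+ 2 / T * (k%:R * T).
Proof.
elim: k => [|k IH]; first by rewrite !mul0r mulr0 subrr.
have cv : continuous (fun t => `|speed t|).
  by move=> x; apply: cvg_norm; exact: continuous_speed.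
have kT : -1 <= k%:R * T by rewrite (@le_trans _ _ 0)// mulr_ge0// ltW.
have -> : log_growth (k.+1%:R * T) = log_growth (k%:R * T) + d ^+ 2 * (4 * eps).
  rewrite -natr1 mulrDl mul1r /log_growth.
  rewrite (Rintegral_itv_split kT _ cv); last by rewrite lerDl ltW.
  by rewrite Rintegral_norm_speed mulrDr.
by rewrite addrAC IH -natr1; field; rewrite gt_eqF.
Qed.

Lemma decay_rate_curve_mx n :
  (decay_rate (curve_mx n.+2) <= (4 * eps * d ^+ 2 / T)%:E)%E.
Proof.
apply: (@decay_rate_le _ _ _ (curve n.+2) _ T) => //.
- by rewrite !mulr_ge0 ?invr_ge0 ?sqr_ge0 ?ltW.
- exact: continuous_curve_mx.
- exact: is_derive_curve.
- by rewrite enorm_curve expR_gt0.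
- by move=> k; rewrite !enorm_curve subrr expR0 mul1r log_growth_period.
Qed.

Lemma worst_rate_le n b : (2 <= n)%N ->
    (forall i, a <= gram i) -> (forall i, gram i <= b) ->
  (worst_rate a b T n <= (4 * eps * d ^+ 2 / T)%:E)%E /\
  (worst_rate_rank_le1 a b T n <= (4 * eps * d ^+ 2 / T)%:E)%E.
Proof.
case: n => [|[|n]]// _ ag gb; have S_PE := @Sym_PE_curve_mx n.+2 b ag gb.
have h := decay_rate_curve_mx n.
split; apply: le_trans h; apply: ereal_inf_lbound; exists (curve_mx n.+2) => //.
by split=> //; exists (curve_vec n.+2).
Qed.

End curve.

(** * Choice of the parameters *)

Section parameters.
Context {R : realType}.

Lemma sin_le_id (x : R) : 0 <= x -> sin x <= x.
Proof.
move=> x0; have cs : {within `[0, x], continuous (@sin R)}.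
  by apply: continuous_subspaceT; exact: continuous_sin.
have ds y : y \in `]0, x[ -> is_derive y (1 : R) (@sin R) (cos y).
  by move=> _; exact: is_derive_sin.
have [y _] := @MVT_segment _ _ _ _ _ x0 ds cs.
by rewrite sin0 !subr0 => ->; rewrite ler_piMl// cos_le1.
Qed.

(** By the mean value theorem [sin x = x * cos y] with [0 < y < 1], and
    [cos y = 1 - 2 * sin (y / 2) ^+ 2] is at least 1/2 there. *)
Lemma half_le_sin (x : R) : 0 <= x <= 1 -> x / 2 <= sin x.
Proof.
move=> /andP[x0 x1]; have cs : {within `[0, x], continuous (@sin R)}.
  by apply: continuous_subspaceT; exact: continuous_sin.
have ds y : y \in `]0, x[ -> is_derive y (1 : R) (@sin R) (cos y).
  by move=> _; exact: is_derive_sin.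
have [y] := @MVT_segment _ _ _ _ _ x0 ds cs.
rewrite in_itv/= => /andP[y0 yx]; rewrite sin0 !subr0 => ->.
rewrite mulrC ler_wpM2r//.
have -> : cos y = 1 - 2 * sin (y / 2) ^+ 2.
  rewrite {1}(_ : y = (y / 2) *+ 2); last by rewrite -mulr_natr; field.
  by rewrite cos_mulr2n cos2sin2; ring.
have s1 : sin (y / 2) <= y / 2 by apply: sin_le_id; lra.
have s0 : 0 <= sin (y / 2) by apply: sin_ge0_pi; have := pi_ge2 R; lra.
have : sin (y / 2) ^+ 2 <= 2^-1 ^+ 2 by rewrite ler_pXn2r ?nnegrE//; lra.
by rewrite !expr2; lra.
Qed.

(** Replace [x] by the smaller [sin x], factor out [1 - cos x = 2 * sin (x / 2) ^+ 2], and apply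
    [half_le_sin] at [x] and [x / 2]. For a small amplitude this keeps the smaller planar entry of
    [gram] above [a]. *)
Lemma cube_le_id_sub_sin_cos (x : R) : 0 <= x <= 1 ->
  x ^+ 3 / 16 <= x - sin x * cos x.
Proof.
move=> /andP[x0 x1].
have s1 : x / 2 <= sin x by apply: half_le_sin; lra.
have s2 : x / 2 / 2 <= sin (x / 2) by apply: half_le_sin; lra.
have c1 : 1 - cos x = 2 * sin (x / 2) ^+ 2.
  rewrite {1}(_ : x = (x / 2) *+ 2); last by rewrite -mulr_natr; field.
  by rewrite cos_mulr2n cos2sin2; ring.
have sx := sin_le_id x0.
apply: (@le_trans _ _ (sin x * (1 - cos x))); last by lra.
rewrite c1.
have -> : x ^+ 3 / 16 = x / 2 * (2 * (x / 2 / 2) ^+ 2) by field.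
apply: ler_pM => //; [lra|by rewrite mulr_ge0// sqr_ge0|].
by rewrite ler_pM2l// ler_pXn2r ?nnegrE//; lra.
Qed.

Lemma exists_gram_bounds (a b : R) : 0 < a -> a <= b ->
  exists eps d : R, [/\ 0 < eps, 0 < d,
    forall i, a <= gram eps d a i <= b &
    4 * eps * d ^+ 2 <= 4096 * a / (1 + b ^+ 2)].
Proof.
move=> a0 ab; have b0 : 0 < b by lra.
have pb : 0 < 1 + b ^+ 2 by rewrite ltr_pwDl// sqr_ge0.
(* [d = 1] makes the integral isotropic, which suffices when [b] is bounded. *)
have [b8|b8] := leP b 8.
  exists (a / 4), 1; split => //; first by lra.
    by case=> [|[|i]]; rewrite /gram /= ?expr1n; lra.
  rewrite expr1n ler_pdivlMr// expr2.
  have : b * b <= 64 by nra.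
  nra.
have [ab32|ab32] := leP (32 * a) b.
  (* Here [dl] is [d ^+ 2]. Its value makes [2 * (dl^-1 * (2 * e))] equal to [b], which dominates
     both planar entries because [dl <= 1]. Both entries are at least [2 * (dl^-1 * (e - sc))],
     hence at least [b * e ^+ 2 / 32] by the cubic bound; the choice of [e] turns this into [a]. *)
  pose e := Num.sqrt (32 * a / b); pose dl := 4 * e / b.
  have e2 : e ^+ 2 = 32 * a / b.
    by rewrite sqr_sqrtr// divr_ge0 ?mulr_ge0// ltW.
  have e0 : 0 < e by rewrite sqrtr_gt0 divr_gt0// mulr_gt0.
  have e1 : e <= 1.
    rewrite -(@ler_pXn2r _ 2)// ?nnegrE ?(ltW e0)// e2 expr1n.
    by rewrite ler_pdivrMr// mul1r.
  have dl0 : 0 < dl by rewrite divr_gt0// mulr_gt0.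
  have dl1 : dl <= 1 by rewrite ler_pdivrMr// mul1r; lra.
  have vdl : dl^-1 = b / (4 * e) by rewrite invf_div.
  have vd1 : dl <= dl^-1.
    by rewrite (le_trans dl1)// invf_ge1.
  have d2 : Num.sqrt dl ^+ 2 = dl by rewrite sqr_sqrtr// ltW.
  have sc0 : 0 <= sin e * cos e.
    have p2 := pihalf_ge1 R.
    by rewrite mulr_ge0// ?sin_ge0_pi ?cos_ge0_pihalf//; lra.
  have sc1 := cube_le_id_sub_sin_cos (x := e).
  have {}sc1 : e ^+ 3 / 16 <= e - sin e * cos e by apply: sc1; lra.
  have sc2 : sin e * cos e <= e.
    by rewrite -subr_ge0 (le_trans _ sc1)// divr_ge0// exprn_ge0// ltW.
  move: sc0 sc1 sc2; set sc := sin e * cos e => sc0 sc1 sc2.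
  have k1 : a <= 2 * (dl^-1 * (e - sc)).
    have -> : a = 2 * (dl^-1 * (e ^+ 3 / 16)).
      have -> : a = b * e ^+ 2 / 32 by rewrite e2; field; rewrite gt_eqF.
      by rewrite vdl; field; rewrite gt_eqF.
    by rewrite ler_pM2l// ler_pM2l// invr_gt0.
  have k2 : b = 2 * (dl^-1 * (2 * e)).
    by rewrite vdl; field; rewrite gt_eqF.
  have m1 : dl * (e - sc) <= dl^-1 * (e - sc) by rewrite ler_wpM2r// subr_ge0.
  have m2 : dl * (e + sc) <= dl^-1 * (e + sc) by rewrite ler_wpM2r//; lra.
  have m3 : 0 <= dl * (e - sc) by rewrite mulr_ge0 ?(ltW dl0)// subr_ge0.
  have m4 : 0 <= dl * (e + sc) by rewrite mulr_ge0 ?(ltW dl0)//; lra.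
  have m5 : dl^-1 * (e - sc) <= dl^-1 * (e + sc).
    by rewrite ler_wpM2l ?invr_ge0 ?(ltW dl0)//; lra.
  have m6 : dl^-1 * (2 * e) = dl^-1 * (e - sc) + dl^-1 * (e + sc) by ring.
  exists e, (Num.sqrt dl); split => //; first by rewrite sqrtr_gt0.
    by case=> [|[|i]]; rewrite /gram /= ?d2 -/sc; lra.
  rewrite d2 ler_pdivlMr//.
  have -> : 4 * e * dl = 512 * a / b ^+ 2.
    have -> : 4 * e * dl = 16 * e ^+ 2 / b by rewrite /dl; field; rewrite gt_eqF.
    by rewrite e2; field; rewrite gt_eqF.
  rewrite mulrAC ler_pdivrMr ?exprn_gt0//.
  have : 1 + b ^+ 2 <= 8 * b ^+ 2 by rewrite expr2; nra.
  by rewrite -(ler_pM2l a0); lra.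
(* If [b < 32 a], take [eps = pi / 2], for which the integral is isotropic. *)
pose m := b / pi; have pi0 := pi_gt0 R.
have pi4 : pi < 4 :> R by have := pihalf_lt2 R; lra.
have m2 : 2 <= m by rewrite ler_pdivlMr//; lra.
(* With [eps = pi / 2] both planar entries are [pi * (dl + dl^-1)]. They equal [b] when [dl] is a
   root of [x + x^-1 = m]; the smaller root, written [2 / (m + s)], visibly satisfies
   [dl <= 2 / m]. *)
pose s := Num.sqrt (m ^+ 2 - 4).
have s2 : s ^+ 2 = m ^+ 2 - 4 by rewrite sqr_sqrtr// expr2; nra.
have s0 : 0 <= s := sqrtr_ge0 _.
pose dl := 2 / (m + s).
have dl0 : 0 < dl by rewrite divr_gt0//; lra.
have d2 : Num.sqrt dl ^+ 2 = dl by rewrite sqr_sqrtr// ltW.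
have msn : m + s != 0 by rewrite gt_eqF//; lra.
have dlE : dl + dl^-1 = m.
  rewrite /dl invf_div -[RHS](_ : (4 + m ^+ 2 + 2 * m * s + s ^+ 2) / (2 * (m + s)) = m).
    by field.
  by rewrite s2; field.
have dlm : dl <= 2 / m.
  by rewrite ler_pM2l// lef_pV2 ?posrE//; lra.
have bE : b = pi * (dl + dl^-1) by rewrite dlE mulrC divfK// gt_eqF.
have planar : 2 * (dl * (pi / 2) + dl^-1 * (pi / 2)) = b.
  by rewrite [RHS]bE; field; rewrite gt_eqF.
exists (pi / 2), (Num.sqrt dl); split => //; [lra|by rewrite sqrtr_gt0| |].
  case=> [|[|i]]; rewrite /gram /= ?d2 ?cos_pihalf ?mulr0 ?addr0 ?subr0; last by lra.
  - by rewrite planar; lra.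
  - by rewrite planar; lra.
rewrite d2; apply: (@le_trans _ _ (4 * (pi / 2) * (2 / m))).
  by rewrite ler_pM2l//; lra.
rewrite (_ : 4 * (pi / 2) * (2 / m) = 4 * pi ^+ 2 / b); last first.
  rewrite /m; move: (lt0r_neq0 pi0); move: (pi : R) => p p0.
  by field; rewrite p0 gt_eqF.
rewrite ler_pdivlMr// mulrAC ler_pdivrMr//.
have : pi ^+ 2 <= 16 :> R by rewrite expr2; nra.
have : 1 + b ^+ 2 <= 2 * b ^+ 2 by rewrite expr2; nra.
move: (sqr_ge0 (pi : R)); move: (pi ^+ 2) => P h0 h2 h1.
(* The factor 32 from [b < 32 * a] completes the constant: [4 * 16 * 2 * 32 = 4096]. *)
apply: (@le_trans _ _ (4 * 16 * (2 * b ^+ 2))).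
  by rewrite -!mulrA ler_pM2l// ler_pM// ltW.
have : b * b <= 32 * a * b by rewrite ler_pM2r// ltW.
by rewrite expr2; lra.
Qed.

End parameters.

Unset Implicit Arguments.

Theorem theorem1p1 (R : realType) :
  exists C0 : R, 0 < C0 /\
    forall (a b T : R) (n : nat), 0 < a -> a <= b -> 0 < T -> (2 <= n)%N ->
      (worst_rate a b T n <= (C0 * a / ((1 + b ^+ 2) * T))%:E)%E /\
      (worst_rate_rank_le1 a b T n <= (C0 * a / ((1 + b ^+ 2) * T))%:E)%E.
Proof.
exists 4096; split; [by rewrite ltr0n|move=> a b T n a0 ab T0 n2].
have [eps [d [eps0 d0 gram_ab le_rate]]] := exists_gram_bounds a0 ab.
have [||h1 h2] := worst_rate_le T0 eps0 d0 a0 n2 (b := b).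
- by move=> i; have /andP[] := gram_ab i.
- by move=> i; have /andP[] := gram_ab i.
have h : 4 * eps * d ^+ 2 / T <= 4096 * a / ((1 + b ^+ 2) * T).
  by rewrite invfM [leRHS]mulrA ler_pM2r ?invr_gt0.
by split; [apply: le_trans h1 _|apply: le_trans h2 _]; rewrite lee_fin.
Qed.
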